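(* Let $U\in\mathbb{R}^{m\times n}$, $V\in\mathbb{R}^{p\times n}$, and let $Q\in\mathbb{R}^{n\times n}$ be symmetric. Consider the following statements: (1) There exists a matrix $X\in\mathbb{R}^{m\times p}$ such that $Q+U^\top XV+V^\top X^\top U=0$. (2) $x^\top Qx=0$ for all $x\in\ker U\cup\ker V$. (3) $\ker U\cap\ker V\subseteq\ker Q$. Then (1) holds if and only if (2) and (3) both hold.
   Context: All matrices are real; $\ker A=\{v\mid Av=0\}$. *)

(* Defs.v *)
From mathcomp Require Import all_boot all_order all_algebra.
From mathcomp Require Import classical_sets reals.

Set Implicit Arguments.
Unset Strict Implicit.
Unset Printing Implicit Defensive.

Import GRing.Theory.
Local Open Scope ring_scope.
Local Open Scope classical_set_scope.

(* Right kernel, on column vectors; MathComp's [kermx] is the left kernel,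
   on row vectors. *)
Definition ker (R : realType) (m n : nat) (A : 'M[R]_(m, n)) : set 'cV[R]_n :=
  [set v | A *m v = 0].

(* Main.v *)
(** Pseudo-inverses give [A] and [B] with [U A = 0], [V B = 0], [A] killing
    [ker V], [B] killing [ker U], such that [1 - A] sends [ker U] and [1 - B]
    sends [ker V] into [ker U `&` ker V].  With [C = 1 - A - B], condition (2)
    removes the terms [A^T Q A] and [B^T Q B] from the expansion of [Q] along
    [1 = A + B + C], and what is left is [Y + Y^T] for
    [Y = B^T Q (A + C) + C^T Q A + C^T Q C / 2].  By (3), [Y] vanishes when its
    left argument is in [ker U] or its right argument is in [ker V], hence
    [- Y] factors as [U^T X V]. *)
Require Import Defs.
From mathcomp Require Import all_boot all_order all_algebra.
From mathcomp Require Import classical_sets reals.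

Import GRing.Theory Num.Theory.

Local Open Scope ring_scope.
Local Open Scope classical_set_scope.

(** Polarization: the form at [e_i + e_j] reduces to [2 S i j], and 2 is nonzero in [F]. *)
Lemma symmetric_quadratic_eq0 (F : numFieldType) (n : nat) (S : 'M[F]_n) :
  S^T = S -> (forall v : 'cV[F]_n, v^T *m S *m v = 0) -> S = 0.
Proof.
move=> Ssym S0.
have entry i j : (delta_mx i 0 : 'cV[F]_n)^T *m S *m delta_mx j 0 = (S i j)%:M.
  by rewrite trmx_delta -rowE -colE [LHS]mx11_scalar !mxE.
apply/matrixP => i j; rewrite mxE.
have := S0 (delta_mx i 0 + delta_mx j 0).
rewrite [(_ + _)^T]linearD !mulmxDl !mulmxDr !S0 add0r addr0 !entry.
rewrite -{2}Ssym mxE -raddfD => /matrixP/(_ 0 0).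
rewrite !mxE eqxx mulr1n -mulr2n => /eqP.
by rewrite mulrn_eq0 => /eqP.
Qed.

(** The columns of [cokermx V] span [ker V], so the hypotheses put the rows of [Y] in the row space
    of [V] and those of [Y^T] in that of [U]. *)
Lemma factor_vanishing (F : fieldType) (m n p : nat)
    (U : 'M[F]_(m, n)) (V : 'M[F]_(p, n)) (Y : 'M[F]_n) :
  Y *m cokermx V = 0 -> Y^T *m cokermx U = 0 ->
  exists X : 'M[F]_(m, p), Y = U^T *m X *m V.
Proof.
move=> /eqP; rewrite -submxE => /mulmxKpV YV.
move=> /eqP; rewrite -submxE => /mulmxKpV YU.
exists ((Y^T *m pinvmx U)^T *m pinvmx V).
by rewrite mulmxA -trmx_mul YU trmxK YV.
Qed.

(** Take [A = K G V] with [K = cokermx U] and [G] a pseudo-inverse of [V K]; then [V K G V K = V K]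
    gives the last equation. *)
Lemma partial_kernel_proj (F : fieldType) (m n p : nat)
    (U : 'M[F]_(m, n)) (V : 'M[F]_(p, n)) :
  exists A : 'M[F]_n, [/\ U *m A = 0, A *m cokermx V = 0
    & V *m ((1%:M - A) *m cokermx U) = 0].
Proof.
have := mulmxKpV (submx_refl (V *m cokermx U)).
(* The kernel bases are made opaque, as [mulmxA] would unfold [cokermx]. *)
move: (pinvmx (V *m cokermx U)) => G.
move: (cokermx U) (mulmx_coker U) (cokermx V) (mulmx_coker V).
move=> K UK L VL VKG.
exists (K *m G *m V); split.
- by rewrite !mulmxA UK !mul0mx.
- by rewrite -mulmxA VL mulmx0.
- by rewrite mulmxBl mul1mx mulmxBr !mulmxA -{1}VKG !mulmxA subrr.
Qed.

Lemma sandwich_equation_solvable (F : numFieldType) (m n p : nat)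
    (U : 'M[F]_(m, n)) (V : 'M[F]_(p, n)) (Q : 'M[F]_n) :
  Q^T = Q ->
  (forall x : 'cV[F]_n, U *m x = 0 -> x^T *m Q *m x = 0) ->
  (forall x : 'cV[F]_n, V *m x = 0 -> x^T *m Q *m x = 0) ->
  (forall x : 'cV[F]_n, U *m x = 0 -> V *m x = 0 -> Q *m x = 0) ->
  exists X : 'M[F]_(m, p), Q + U^T *m X *m V + V^T *m X^T *m U = 0.
Proof.
move=> Qsym QU QV QUV.
(* The columns of [M] lie in [ker W], so the symmetric matrix [M^T Q M] has zero quadratic form. *)
have isotropic k (W : 'M[F]_(k, n)) (M : 'M[F]_n) :
    (forall x : 'cV[F]_n, W *m x = 0 -> x^T *m Q *m x = 0) ->
    W *m M = 0 -> M^T *m Q *m M = 0.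
  move=> QW WM; apply: symmetric_quadratic_eq0 => [|v].
    by rewrite !trmx_mul trmxK Qsym mulmxA.
  have := QW (M *m v); rewrite mulmxA WM mul0mx trmx_mul !mulmxA.
  exact.
have kerQ (M : 'M[F]_n) : U *m M = 0 -> V *m M = 0 -> Q *m M = 0.
  move=> UM VM; apply/matrixP => i j.
  have /colP/(_ i) : Q *m (M *m delta_mx j (0 : 'I_1)) = 0.
    by apply: QUV; rewrite mulmxA (UM, VM) mul0mx.
  by rewrite mulmxA -colE mxE => ->; rewrite !mxE.
have [A [UA AV VA]] := partial_kernel_proj _ _ _ _ U V.
have [B [VB BU UB]] := partial_kernel_proj _ _ _ _ V U.
pose C : 'M[F]_n := 1%:M - A - B.
(* On [ker U], [C] acts as [1 - A], whose values there lie in both kernels. *)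
have QCU : Q *m (C *m cokermx U) = 0.
  rewrite [C *m _]mulmxBl BU subr0; apply: kerQ => //.
  by rewrite mulmxA mulmxBr mulmx1 UA subr0 mulmx_coker.
have QCV : Q *m (C *m cokermx V) = 0.
  rewrite /C addrAC [X in Q *m X]mulmxBl AV subr0; apply: kerQ => //.
  by rewrite mulmxA mulmxBr mulmx1 VB subr0 mulmx_coker.
have ABC : A + B + C = 1%:M by rewrite /C -[1%:M - A - B]addrA -opprD subrKC.
move: C QCU QCV ABC => C QCU QCV ABC.
pose Y : 'M[F]_n := B^T *m Q *m (A + C) + C^T *m Q *m A + 2^-1 *: (C^T *m Q *m C).
have YT : Y^T = A^T *m Q *m B + C^T *m Q *m B + A^T *m Q *m C + 2^-1 *: (C^T *m Q *m C).
  by rewrite /Y !linearD linearZ /= !trmx_mul !trmxK Qsym !mulmxA.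
have YV : - Y *m cokermx V = 0.
  rewrite mulNmx /Y !mulmxDl -scalemxAl mulmxDr mulmxDl -!mulmxA AV QCV.
  by rewrite !mulmx0 scaler0 !addr0 oppr0.
have YU : (- Y)^T *m cokermx U = 0.
  rewrite linearN /= YT mulNmx !mulmxDl -scalemxAl -!mulmxA BU QCU.
  by rewrite !mulmx0 scaler0 !addr0 oppr0.
have [X YX] := factor_vanishing _ _ _ _ _ _ _ YV YU.
exists X.
have -> : V^T *m X^T *m U = (- Y)^T by rewrite YX !trmx_mul trmxK mulmxA.
rewrite -YX linearN /= -addrA -opprD; apply/eqP; rewrite subr_eq0; apply/eqP.
have defQ : Q = (A + B + C)^T *m Q *m (A + B + C).
  by rewrite ABC trmx1 mul1mx mulmx1.
have half (Z : 'M[F]_n) : Z = 2^-1 *: Z + 2^-1 *: Z.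
  by rewrite -scalerDl -[2^-1]mul1r -splitr scale1r.
(* Of the nine products, two vanish by isotropy; halving [C^T Q C] leaves eight summands, four for
   [Y] and four for [Y^T]. *)
rewrite {1}defQ YT /Y !linearD /= !(mulmxDl, mulmxDr).
rewrite (isotropic _ _ _ QU UA) (isotropic _ _ _ QV VB).
rewrite {1}(half (C^T *m Q *m C)) !add0r !addr0.
by rewrite [LHS](AC ((2*2)*(2*2)) ((1*6*2*7)*(3*4*5*8))).
Qed.

Theorem lemma1 (R : realType) (m n p : nat)
    (U : 'M[R]_(m, n)) (V : 'M[R]_(p, n)) (Q : 'M[R]_n) (Qsym : Q^T = Q) :
  (exists X : 'M[R]_(m, p), Q + U^T *m X *m V + V^T *m X^T *m U = 0) <->
  ((forall x : 'cV[R]_n, (ker U `|` ker V) x -> x^T *m Q *m x = 0) /\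
   ker U `&` ker V `<=` ker Q).
Proof.
split=> [[X QX]|[Qiso Qker]].
(* Each summand has [U] on one side and [V] on the other, so a vector of either kernel annihilates
   both when placed on both sides. *)
- have {QX}-> : Q = - (U^T *m X *m V + V^T *m X^T *m U).
    by apply/eqP; rewrite -addr_eq0 addrA QX.
  split=> [x [Kx|Kx]|x [Ux Vx]].
  + have Kxt : x^T *m U^T = 0 by rewrite -trmx_mul Kx trmx0.
    rewrite mulmxN mulNmx mulmxDr mulmxDl -!mulmxA Kx !mulmxA Kxt.
    by rewrite !mulmx0 !mul0mx addr0 oppr0.
  + have Kxt : x^T *m V^T = 0 by rewrite -trmx_mul Kx trmx0.
    rewrite mulmxN mulNmx mulmxDr mulmxDl -!mulmxA Kx !mulmxA Kxt.
    by rewrite !mulmx0 !mul0mx addr0 oppr0.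
  + by rewrite /ker /= mulNmx mulmxDl -!mulmxA Ux Vx !mulmx0 addr0 oppr0.
- apply: sandwich_equation_solvable => // x.
  + by move=> Ux; apply: Qiso; left.
  + by move=> Vx; apply: Qiso; right.
  + by move=> Ux Vx; apply: Qker; split.
Qed.
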